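(* Let $s \in \mathbb{R}$ with $s \notin \mathbb{Q}$, and let $\mu = \mu(s)$ be its approximation exponent. Then $$\limsup_{|t| \rightarrow \infty} \frac{\log(\alpha_1(h_t \Lambda_s))}{\log |t|} = 1-\frac{1}{\mu},$$ and $$\limsup_{t \rightarrow \infty} \frac{\log(\alpha_1(g_{-t} \Lambda_s))}{t} = \frac{1}{2}-\frac{1}{\mu}.$$
   Context: For $t, s \in \mathbb{R}$, $$h_t = \begin{pmatrix} 1 & t \\ 0 & 1 \end{pmatrix}, \qquad g_t = \begin{pmatrix} e^{t/2} & 0 \\ 0 & e^{-t/2} \end{pmatrix}, \qquad \Lambda_s = \begin{pmatrix} 1 & 0 \\ s & 1 \end{pmatrix}\mathbb{Z}^2,$$ so $\Lambda_s$ is a unimodular lattice in $\mathbb{R}^2$; matrices act on lattices by $g\Lambda = \{gv : v\in\Lambda\}$. For a lattice $\Lambda \subset \mathbb{R}^2$, $\alpha_1(\Lambda) = \sup_{0 \neq v \in \Lambda} \frac{1}{\|v\|}$ with $\|\cdot\|$ the Euclidean norm. The approximation exponent of $s$ is $$\mu(s) = \sup\left\{\nu \in \mathbb{R} : \left|s - \tfrac{p}{q}\right| < \tfrac{1}{q^\nu} \text{ has infinitely many solutions } \tfrac{p}{q} \in \mathbb{Q}\right\},$$ where rationals $p/q$ are written with $q > 0$. The value $\mu(s) = \infty$ is allowed, with the convention $1/\infty = 0$. *)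

(* Defs.v *)
From HB Require Import structures.
From mathcomp Require Import all_boot all_order all_algebra.
From mathcomp Require Import all_classical all_reals all_analysis.

Set Implicit Arguments.
Unset Strict Implicit.
Unset Printing Implicit Defensive.

Import Order.TTheory GRing.Theory Num.Theory.
Import numFieldNormedType.Exports.

Local Open Scope classical_set_scope.
Local Open Scope ring_scope.

Definition mx2 (R : realType) (a b c d : R) : 'M[R]_2 :=
  \matrix_(i < 2, j < 2)
    if i == 0 then (if j == 0 then a else b) else (if j == 0 then c else d).

Definition horo (R : realType) (t : R) : 'M[R]_2 := mx2 1 t 0 1.

Definition geod (R : realType) (t : R) : 'M[R]_2 :=
  mx2 (expR (t / 2)) 0 0 (expR (- t / 2)).

Definition act_set (R : realType) (g : 'M[R]_2) (L : set 'cV[R]_2)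
  : set 'cV[R]_2 := [set g *m v | v in L].

Definition Zvect2 (R : realType) : set 'cV[R]_2 :=
  range (fun z : 'cV[int]_2 => map_mx intr z).

Definition Lambda (R : realType) (s : R) : set 'cV[R]_2 :=
  act_set (mx2 1 0 s 1) (@Zvect2 R).

(* The canonical norm on matrices in MathComp-Analysis is the sup norm. *)
Definition enorm (R : realType) (v : 'cV[R]_2) : R :=
  Num.sqrt (\sum_(i < 2) v i 0 ^+ 2).

(* For a lattice the set is nonempty and bounded, so that the default value
   of the real supremum plays no role. *)
Definition alpha1 (R : realType) (L : set 'cV[R]_2) : R :=
  sup [set 1 / enorm v | v in L `\ 0].

(* The solutions are counted as rational numbers, not as pairs (p, q). *)
Definition approx_solutions (R : realType) (s nu : R) : set rat :=
  [set x | exists p q : int, [/\ 0 < q, x = p%:~R / q%:~R &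
    `| s - p%:~R / q%:~R | < 1 / (q%:~R `^ nu) ] ].

Definition approx_exponent (R : realType) (s : R) : \bar R :=
  ereal_sup [set nu%:E | nu in [set nu | infinite_set (approx_solutions s nu)]].

(* The filter |t| --> +oo, both signs of t being allowed. *)
Definition abs_pinfty_nbhs (R : realType) : set_system R :=
  [set P | exists M : R, forall t, M < `|t| -> P t].

(* Main.v *)
Require Import Defs.
From HB Require Import structures.
From mathcomp Require Import all_boot all_order all_algebra.
From mathcomp Require Import all_classical all_reals all_analysis.
From mathcomp Require Import ring lra.

Set Implicit Arguments.
Unset Strict Implicit.
Unset Printing Implicit Defensive.

Import Order.TTheory GRing.Theory Num.Theory.
Import numFieldNormedType.Exports.

Local Open Scope classical_set_scope.
Local Open Scope ring_scope.

(** Write a vector of [Lambda s] as [(m, m * s + n)] with integers [m], [n];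
    its second coordinate is small compared with [1 / m] when [- n / m] is a
    good approximation of [s].  Both [horo t] and [geod (- ln tau)] convert the
    quality of such an approximation into the length of a short vector, and they
    do it in the same way: if [|q * s + p| = q / tau], then [horo t] with
    [t = - q / (q * s + p)] has [|t| = tau], kills the first coordinate and
    leaves length [q / tau], while [geod (- ln tau)] makes both coordinates
    equal to [q / sqrt tau] in absolute value.  Everything thus depends on how
    [q] compares with powers of [tau].

    - If [nu > 0] and [|s - p / q| < q ^ - nu] has infinitely many solutions,
      then [tau = 1 / |s - p / q|] is unbounded along them and
      [q <= tau ^ (1 / nu)] ([good_approximations]).  The two short vectors show
      that the limsups are at least [1 - 1 / nu] and [1 / 2 - 1 / nu]
      ([horo_limsup_ge], [geod_limsup_ge]).
    - If there are finitely many solutions, and [nu >= 1], then for some [c > 0]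
      and every [tau >= 1], all [m <> 0] with [|m| < T = tau ^ (1 / nu)] satisfy
      [|m * s + n| >= c * T / tau] ([gap_of_finite]).  The image of a vector with
      such an [m] is long because of its second coordinate.  If [|m| >= T], its
      first coordinate is long, unless under [horo t] the shear cancels [m],
      which again takes a large [m * s + n] ([no_short_horo], [no_short_geod]).
      The limsups are then at most [1 - 1 / nu] and [1 / 2 - 1 / nu].

    With [T = 1] there is no such [m], and the second argument holds for every
    [s], with [0] in place of [1 / nu].  This gives the upper bounds [1] and
    [1 / 2], which settle the case of an infinite exponent, and the positive
    lower bound on lengths that makes the supremum defining [alpha1] meaningful.
    Finally [nu = 1] always has infinitely many solutions, so the exponent is at
    least [1].  The limsups are determined by comparing them with the values at
    [nu] below the exponent and, if it is finite, above it ([esup_inv_eq]). *)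

(** * Rational approximations *)

Lemma irrational_finite_gap (R : realType) (s : R) (A : set rat) :
  irrational s -> finite_set A ->
  exists2 c : R, 0 < c <= 1 & forall x, A x -> c <= `|s - ratr x|.
Proof.
move=> hs /finite_seqP[r ->]; elim: r => [|x r [c /andP[c0 c1] cP]].
  by exists 1 => //=; rewrite ltr01 lexx.
have sx : 0 < `|s - ratr x|.
  by rewrite normr_gt0 subr_eq0; apply/eqP => sE; apply: hs; exists x.
exists (Num.min c `|s - ratr x|).
  by rewrite lt_min c0 sx ge_min c1.
move=> y /=; rewrite inE => /orP[/eqP ->|yr]; rewrite ge_min ?lexx ?orbT//.
by rewrite cP.
Qed.

Lemma ratr_fracz (R : realType) (p q : int) :
  ratr (p%:~R / q%:~R) = p%:~R / q%:~R :> R.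
Proof. by rewrite fmorph_div/= !ratr_int. Qed.

(** The fractions [floor (s * q) / q] come arbitrarily close to [s], which
    those in a finite set cannot do.  It follows that every [nu] above the
    exponent is at least [1], the range in which a gap is available. *)
Lemma approx_solutions1_infinite (R : realType) (s : R) :
  irrational s -> infinite_set (approx_solutions s 1).
Proof.
move=> hs /(irrational_finite_gap hs)[c /andP[c0 _] cP].
pose q : int := Num.floor c^-1 + 1.
have cq : c^-1 < q%:~R :> R by exact: floorD1_gt.
have q0 : 0 < q%:~R :> R by apply: lt_trans cq; rewrite invr_gt0.
pose p : int := Num.floor (s * q%:~R).
have /andP[p1 p2] := floor_itv (s * q%:~R); rewrite -/p in p1 p2.
have spq : `|s - p%:~R / q%:~R| < q%:~R^-1.
  have -> : s - p%:~R / q%:~R = (s * q%:~R - p%:~R) / q%:~R.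
    by field; rewrite gt_eqF.
  rewrite normrM [`|_^-1|]gtr0_norm ?invr_gt0// gtr_pMl ?invr_gt0//.
  by move: p2; rewrite intrD ltr_norml => p2; apply/andP; split; lra.
have /cP : approx_solutions s 1 (p%:~R / q%:~R).
  exists p, q; split => //; first by rewrite -(ltr0z R).
  by rewrite powRr1 ?ltW// div1r.
rewrite ratr_fracz => /le_lt_trans/(_ spq).
rewrite -[c]invrK ltf_pV2 ?posrE ?invr_gt0//.
by move=> /lt_trans/(_ cq); rewrite ltxx.
Qed.

(** The exponent [kappa] stands for [1 / nu].  Indexing by [tau], and not by
    the size of [m], makes the same inequality usable with [tau = |t|] for
    [horo t] and with [tau = expR t] for [geod (- t)]. *)
Definition gap (R : realType) (s kappa c : R) := forall (tau : R) (m n : int),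
  1 <= tau -> m != 0 -> `|m%:~R| < tau `^ kappa ->
  c * (tau `^ kappa / tau) <= `|m%:~R * s + n%:~R|.

Lemma gap0 (R : realType) (s : R) : gap s 0 1.
Proof.
move=> tau m n _ m0; rewrite powRr0 -intr_norm.
by rewrite ltrz1 ltNge -gtz0_ge1 normr_gt0 m0.
Qed.

(** The finitely many exceptional fractions stay at a positive distance from
    [s], so [|s - p / q| >= c * q ^ - nu] for every fraction, reduced or not;
    then [q |-> q ^ (1 - nu)] is nonincreasing, and it takes the value
    [T / tau] at [q = T = tau ^ (1 / nu)]. *)
Lemma gap_of_finite (R : realType) (s nu : R) : irrational s -> 1 <= nu ->
  finite_set (approx_solutions s nu) ->
  exists2 c : R, 0 < c <= 1 & gap s nu^-1 c.
Proof.
move=> hs nu1 /(irrational_finite_gap hs)[c c01 cP]; exists c => //.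
have /andP[c0 c1] := c01.
have nu0 : 0 < nu by lra.
have sol (p q : int) : 0 < q -> c / q%:~R `^ nu <= `|s - p%:~R / q%:~R|.
  move=> q0; have q1 : 1 <= q%:~R :> R by rewrite ler1z -gtz0_ge1.
  have qnu1 : 1 <= q%:~R `^ nu by apply: (le_trans q1); apply: le1r_powR.
  have qnu0 : 0 < q%:~R `^ nu by lra.
  have [lt_sol|] := ltP `|s - p%:~R / q%:~R| (1 / q%:~R `^ nu).
    rewrite -ratr_fracz; apply: (@le_trans _ _ c); last first.
      by apply: cP; exists p, q.
    by rewrite ler_pdivrMr// ler_peMr// ltW.
  by apply: le_trans; rewrite ler_pM2r// invr_gt0.
move=> tau m n tau1 m0; set T := tau `^ nu^-1 => mT.
(* [m * s + n] is, up to sign, [q * (s - p / q)] for this [p / q]. *)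
pose q : int := `|m|; pose p : int := - Num.sg m * n.
have q0 : 0 < q by rewrite normr_gt0.
have qR0 : 0 < q%:~R :> R by rewrite ltr0z.
have -> : `|m%:~R * s + n%:~R| = q%:~R * `|s - p%:~R / q%:~R|.
  rewrite -[X in _ = X * _](gtr0_norm qR0) -normrM mulrBr mulrCA divff ?gt_eqF//.
  rewrite mulr1 /p mulNr rmorphN opprK rmorphM/=.
  have qE : q%:~R = (Num.sg m)%:~R * m%:~R :> R by rewrite -intrM -normrEsg.
  rewrite qE -mulrA -mulrDr normrM.
  by rewrite -intr_norm normr_sg m0 mul1r.
have qT : q%:~R < T by rewrite /q intr_norm.
have tau0 : 0 < tau by lra.
have T0 : 0 < T by exact: lt_trans qT.
have tauE : tau = T * T `^ (nu - 1).
  by rewrite mulr_powRB1 ?ltW// /T -powRrM mulVf ?gt_eqF// powRr1 ?ltW.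
have qE : q%:~R `^ nu = q%:~R * q%:~R `^ (nu - 1).
  by rewrite mulr_powRB1 ?ltW.
apply: (@le_trans _ _ (q%:~R * (c / q%:~R `^ nu))); last first.
  by rewrite ler_pM2l//; exact: sol.
rewrite [in leRHS]mulrCA ler_pM2l// [in leLHS]tauE qE.
rewrite !invfM !mulrA !divff ?gt_eqF// !mul1r lef_pV2 ?posrE ?powR_gt0//.
by apply: ge0_ler_powR; rewrite ?nnegrE ?subr_ge0// ltW.
Qed.

Lemma fracz_bounded_finite (R : realType) (K : R) (A : set rat) :
  (forall x, A x -> exists p q : int,
    [/\ 0 < q, x = p%:~R / q%:~R, q%:~R <= K & `|p%:~R| <= K]) ->
  finite_set A.
Proof.
move=> AP; pose N := (Num.truncn K).+1.
have ltN (k : nat) : k%:R <= K -> (k < N)%N.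
  by move=> kK; rewrite -(ltr_nat R); apply: le_lt_trans kK (truncnS_gt _).
apply: (@sub_finite_set _ _
  [set ((x.1.1)%:R - (x.1.2)%:R) / (x.2)%:R | x in (`I_N `*` `I_N) `*` `I_N]).
  (* A numerator is encoded as a difference of two naturals below [N]. *)
  move=> x /AP[p [q [q0 -> qK pK]]].
  have pN : (`|p| < N)%N by apply: ltN; rewrite natr_absz intr_norm.
  have qN : (`|q| < N)%N by apply: ltN; rewrite natr_absz gtr0_norm.
  have N0 : (0 < N)%N by [].
  have [p0|p0] := leP 0 p.
    exists ((`|p|%N, 0%N), `|q|%N) => //=.
    by rewrite subr0 !natr_absz ger0_norm// gtr0_norm.
  exists ((0%N, `|p|%N), `|q|%N) => //=.
  by rewrite sub0r !natr_absz ltr0_norm// gtr0_norm// rmorphN opprK.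
by apply: finite_image; do ?apply: finite_setX.
Qed.

(** The witness is [tau = 1 / |s - p / q|].  It can be made larger than [M]
    because the solutions with [|s - p / q| >= 1 / M] have bounded denominators
    and numerators, hence are finitely many. *)
Lemma good_approximations (R : realType) (s nu M : R) : irrational s ->
  0 < nu -> infinite_set (approx_solutions s nu) ->
  exists (q p : int) (tau : R),
    [/\ 1 < tau, M < tau, q%:~R <= tau `^ nu^-1, 0 < q &
        `|q%:~R * s + p%:~R| = q%:~R / tau].
Proof.
move=> hs nu0 inf.
pose M1 := Num.max M 1.
pose B := approx_solutions s nu `&` [set x | M1^-1 <= `|s - ratr x|].
have M11 : 1 <= M1 by rewrite le_max lexx orbT.
have M10 : 0 < M1 by lra.
have q_le (t : R) (q : int) : 0 < q -> q%:~R `^ nu < t -> q%:~R <= t `^ nu^-1.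
  move=> q0 qt; have qR0 : 0 < q%:~R :> R by rewrite ltr0z.
  have -> : q%:~R = (q%:~R `^ nu) `^ nu^-1 :> R.
    by rewrite -powRrM divff ?gt_eqF// powRr1// ltW.
  by apply: ge0_ler_powR; rewrite ?nnegrE ?invr_ge0 ?powR_ge0 ?ltW//
    (le_lt_trans (powR_ge0 _ _) qt).
have finB : finite_set B.
  pose N := M1 `^ nu^-1.
  have N0 : 0 <= N by exact: powR_ge0.
  apply: (@fracz_bounded_finite R (N * (`|s| + 1))).
  move=> x [[p [q [q0 -> lt_sol]]] /=]; rewrite ratr_fracz => ge_sol.
  exists p, q; have qR0 : 0 < q%:~R :> R by rewrite ltr0z.
  have qnu0 : 0 < q%:~R `^ nu by rewrite powR_gt0.
  have q1 : 1 <= q%:~R :> R by rewrite ler1z -gtz0_ge1.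
  have qnu1 : 1 <= q%:~R `^ nu by rewrite -[leLHS](powRr0 q%:~R) ler_powR// ltW.
  have qN : q%:~R <= N.
    apply: q_le => //; move: (le_lt_trans ge_sol lt_sol).
    by rewrite div1r ltf_pV2.
  split => //.
    by apply: le_trans qN _; rewrite ler_peMr// lerDr.
  have -> : p%:~R = q%:~R * (s - (s - p%:~R / q%:~R)) :> R.
    by field; rewrite gt_eqF.
  rewrite normrM gtr0_norm// ler_pM ?(ltW qR0)//.
  apply: le_trans (ler_normB _ _) _; rewrite lerD2l.
  by apply/ltW/(lt_le_trans lt_sol); rewrite div1r invf_le1.
have /infinite_setN0[x [[p [q [q0 -> lt_sol]]] notB]] := infinite_setD inf finB.
have sx0 : 0 < `|s - p%:~R / q%:~R|.
  rewrite normr_gt0 subr_eq0; apply/eqP => sE; apply: hs.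
  by exists (p%:~R / q%:~R) => //; rewrite ratr_fracz.
have sx : `|s - p%:~R / q%:~R| < M1^-1.
  rewrite ltNge; apply/negP => h; apply: notB; split; first by exists p, q.
  by rewrite /= ratr_fracz.
have qR0 : 0 < q%:~R :> R by rewrite ltr0z.
have Mtau : M1 < `|s - p%:~R / q%:~R|^-1.
  by rewrite -(invrK M1) ltf_pV2 ?posrE ?invr_gt0.
exists q, (- p), `|s - p%:~R / q%:~R|^-1; split => //.
- by apply: (le_lt_trans M11).
- by apply: (le_lt_trans _ Mtau); rewrite le_max lexx.
- apply: (q_le _ _ q0); rewrite -(invrK (_ `^ _)) ltf_pV2 ?posrE ?invr_gt0 ?powR_gt0//.
  by rewrite -[ltRHS]div1r.
- rewrite invrK -[X in _ = X * _](gtr0_norm qR0) -normrM mulrBr mulrCA divff ?gt_eqF//.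
  by rewrite mulr1 rmorphN.
Qed.

(** * Lengths of lattice vectors *)

Definition col2 (R : realType) (x y : R) : 'cV[R]_2 :=
  \col_i if i == 0 then x else y.

Lemma enorm_col2 (R : realType) (x y : R) :
  enorm (col2 x y) = Num.sqrt (x ^+ 2 + y ^+ 2).
Proof. by rewrite /enorm !big_ord_recl big_ord0 addr0 !mxE. Qed.

Lemma le_enorm_col2 (R : realType) (r x y : R) : 0 <= r ->
  r <= `|x| \/ r <= `|y| -> r <= enorm (col2 x y).
Proof.
move=> r0 xy; rewrite enorm_col2 -(ger0_norm r0) -sqrtr_sqr ler_wsqrtr//.
rewrite -[x ^+ 2]real_normK ?num_real// -[y ^+ 2]real_normK ?num_real//.
by case: xy => h; [rewrite ler_wpDr ?sqr_ge0//|rewrite ler_wpDl ?sqr_ge0//];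
  rewrite lerXn2r ?nnegrE ?normr_ge0.
Qed.

Lemma enorm_col2_le (R : realType) (x y : R) :
  enorm (col2 x y) <= `|x| + `|y|.
Proof.
have xy0 : 0 <= `|x| + `|y| by rewrite addr_ge0.
rewrite enorm_col2 -[leRHS](ger0_norm xy0) -sqrtr_sqr ler_wsqrtr//.
rewrite -[x ^+ 2]real_normK ?num_real// -[y ^+ 2]real_normK ?num_real//.
by rewrite sqrrD lerD2r lerDl mulrn_wge0// mulr_ge0.
Qed.

Lemma act_LambdaE (R : realType) (a b c d s : R) :
  act_set (mx2 a b c d) (Lambda s) =
  [set v | exists m n : int, v = col2
    (a * m%:~R + b * (m%:~R * s + n%:~R)) (c * m%:~R + d * (m%:~R * s + n%:~R))].
Proof.
have mx2_mul (a' b' c' d' : R) (v : 'cV[R]_2) : mx2 a' b' c' d' *m v =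
    col2 (a' * v 0 0 + b' * v 1 0) (c' * v 0 0 + d' * v 1 0).
  apply/colP => i; rewrite !mxE !big_ord_recl big_ord0 addr0 !mxE /=.
  have -> : lift ord0 ord0 = 1 :> 'I_2 by apply/val_inj.
  by case: (i == 0).
apply/seteqP; split => [v /= [_ [_ [z _ <-] <-] <-]|v /= [m [n ->]]].
  exists (z 0 0), (z 1 0); rewrite !mx2_mul !mxE /=.
  by rewrite mul1r mul0r addr0 mul1r [s * _]mulrC.
pose z : 'cV[int]_2 := \col_i if i == 0 then m else n.
exists (mx2 1 0 s 1 *m map_mx intr z).
  by exists (map_mx intr z) => //; exists z.
rewrite !mx2_mul !mxE /=.
by rewrite mul1r mul0r addr0 mul1r [s * _]mulrC.
Qed.

(** Comparing coordinates with [r], and not Euclidean lengths, costs a factor of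
    at most [sqrt 2], and constant factors disappear in the limsups. *)
Definition no_short (R : realType) (a b c d s r : R) := forall m n : int,
  (m != 0) || (n != 0) ->
  r <= `|a * m%:~R + b * (m%:~R * s + n%:~R)| \/
  r <= `|c * m%:~R + d * (m%:~R * s + n%:~R)|.

(** A lower bound on all lengths is needed even to bound [alpha1] from below:
    without it the real supremum could fall back on its default value. *)
Section alpha1.
Variables (R : realType) (a b c d s r : R).
Hypotheses (r0 : 0 < r) (noshort : no_short a b c d s r).
Let L := act_set (mx2 a b c d) (Lambda s).
Let vec (m n : int) := col2 (a * m%:~R + b * (m%:~R * s + n%:~R))
                            (c * m%:~R + d * (m%:~R * s + n%:~R)).

Let enorm_ge v : (L `\ 0) v -> r <= enorm v.
Proof.
rewrite /L act_LambdaE => -[[m [n ->]] /= v0].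
apply: le_enorm_col2; first exact: ltW.
apply: noshort; apply: contra_notT v0; rewrite negb_or !negbK.
move=> /andP[/eqP -> /eqP ->]; apply/colP => i; rewrite !mxE.
by rewrite !(mulr0, mul0r, addr0) if_same.
Qed.

Let nonzero_vec m n : m != 0 -> (L `\ 0) (vec m n).
Proof.
move=> m0; split; first by rewrite /L act_LambdaE; exists m, n.
have : r <= enorm (vec m n).
  by apply: le_enorm_col2; [exact: ltW|apply: noshort; rewrite m0].
move=> /[swap] /= ->; rewrite leNgt => /negP; apply.
by rewrite /enorm big1 ?sqrtr0// => i _; rewrite mxE expr0n.
Qed.

Let alpha1_ubound : ubound [set 1 / enorm v | v in L `\ 0] r^-1.
Proof.
move=> _ [v /enorm_ge rv <-]; rewrite div1r lef_pV2 ?posrE//.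
exact: lt_le_trans rv.
Qed.

Let alpha1_ge m n : m != 0 -> (enorm (vec m n))^-1 <= alpha1 L.
Proof.
move=> m0; apply: ub_le_sup; first by exists r^-1; exact: alpha1_ubound.
by exists (vec m n); [exact: nonzero_vec|rewrite div1r].
Qed.

Let enorm_vec_gt0 m n : m != 0 -> 0 < enorm (vec m n).
Proof. by move=> m0; apply: lt_le_trans r0 _; apply/enorm_ge/nonzero_vec. Qed.

Let alpha1_gt0 : 0 < alpha1 L.
Proof.
by apply: lt_le_trans (@alpha1_ge 1 0 isT); rewrite invr_gt0 enorm_vec_gt0.
Qed.

Lemma ln_alpha1_le : ln (alpha1 L) <= - ln r.
Proof.
rewrite -lnV ?posrE// ler_ln ?posrE ?invr_gt0 ?alpha1_gt0//.
apply: ge_sup; last exact: alpha1_ubound.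
by exists (1 / enorm (vec 1 0)), (vec 1 0) => //; exact: nonzero_vec.
Qed.

Lemma ln_alpha1_ge (e : R) (m n : int) : m != 0 ->
  `|a * m%:~R + b * (m%:~R * s + n%:~R)| +
  `|c * m%:~R + d * (m%:~R * s + n%:~R)| <= e -> - ln e <= ln (alpha1 L).
Proof.
move=> m0 le_e; have ve : enorm (vec m n) <= e.
  exact: le_trans (enorm_col2_le _ _) le_e.
have v0 := enorm_vec_gt0 n m0.
have e0 := lt_le_trans v0 ve.
rewrite -lnV ?posrE// ler_ln ?posrE ?invr_gt0 ?alpha1_gt0//.
by apply: le_trans (alpha1_ge n m0); rewrite lef_pV2 ?posrE.
Qed.

End alpha1.

(** * Upper limits and the exponent *)

Lemma limf_esup_le (R : realType) (f : R -> R) (F : set_system R) (a : R) :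
  (forall e, 0 < e -> F [set t | f t <= a + e]) ->
  (limf_esup (fun t => (f t)%:E) F <= a%:E)%E.
Proof.
move=> fa; apply/lee_addgt0Pr => e e0; rewrite -EFinD.
apply: ge_ereal_inf; exists (ereal_sup [set (f t)%:E | t in [set t | f t <= a + e]]).
  by exists [set t | f t <= a + e] => //; exact: fa.
by apply: ge_ereal_sup => _ [t /= ft <-]; rewrite lee_fin.
Qed.

Lemma limf_esup_ge (R : realType) (f : R -> R) (F : set_system R) (a : R) :
  (forall e V, 0 < e -> F V -> exists2 t, V t & a - e <= f t) ->
  (a%:E <= limf_esup (fun t => (f t)%:E) F)%E.
Proof.
move=> fa; apply/lee_subgt0Pr => e e0; rewrite -EFinB.
apply/ereal_infP => _ [V FV <-]; have [t Vt at_] := fa _ _ e0 FV.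
apply: (@le_trans _ _ (f t)%:E); first by rewrite lee_fin.
by apply: ereal_sup_ubound; exists t.
Qed.

(** Each [nu > 0] in [A] and each [nu >= 1] outside [A] bounds [l] by the same
    quantity [a - 1 / nu], on opposite sides.  Every [nu] above the supremum is
    outside [A], and some [nu] in [A] come arbitrarily close to it, so the two
    bounds meet. *)
Lemma esup_inv_eq (R : realType) (a : R) (A : set R) (l : \bar R) :
  A 1 -> (l <= a%:E)%E ->
  (forall nu, 0 < nu -> A nu -> ((a - nu^-1)%:E <= l)%E) ->
  (forall nu, 1 <= nu -> ~ A nu -> (l <= (a - nu^-1)%:E)%E) ->
  l = (a%:E - (ereal_sup [set nu%:E | nu in A])^-1)%E.
Proof.
move=> A1; case: l => [l la low up|//|_ low _]; last by have := low _ ltr01 A1.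
have inA nu : 0 < nu -> A nu -> a - nu^-1 <= l by move=> ? ?; rewrite -lee_fin low.
rewrite lee_fin in la.
have mu_le : 0 < a - l ->
    (ereal_sup [set nu%:E | nu in A] <= (a - l)^-1%:E)%E.
  move=> al; apply: ge_ereal_sup => _ [nu Anu <-]; rewrite lee_fin.
  have [nu0|nu0] := leP nu 0; first by apply: (le_trans nu0); rewrite invr_ge0 ltW.
  by rewrite -[nu]invrK lef_pV2 ?posrE ?invr_gt0//; have := inA nu nu0 Anu; lra.
have mu_ge nu : A nu -> (nu%:E <= ereal_sup [set nu%:E | nu in A])%E.
  by move=> Anu; apply: ereal_sup_ubound; exists nu.
have := mu_ge 1 A1; move: mu_ge; case muE : (ereal_sup _) => [mu||//] mu_ge mu1.
  have {}mu1 : 1 <= mu by rewrite -lee_fin.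
  have mu0 : 0 < mu by lra.
  have notA nu : mu < nu -> l <= a - nu^-1.
    move=> munu; rewrite -lee_fin; apply: up; first by lra.
    by move=> /mu_ge; rewrite lee_fin; lra.
  have al : 0 < a - l.
    have := notA (mu + 1); have : 0 < (mu + 1)^-1 by rewrite invr_gt0; lra.
    lra.
  rewrite inver gt_eqF// -EFinB; congr (_%:E); apply/eqP.
  have -> : (l == a - mu^-1) = (mu == (a - l)^-1).
    by rewrite -[RHS](inj_eq invr_inj) invrK; apply/eqP/eqP; lra.
  rewrite eq_le; apply/andP; split.
    by have := mu_le al; rewrite muE lee_fin.
  apply/ler_addgt0Pr => e e0.
  have /notA : mu < mu + e by lra.
  by move=> h; rewrite -[mu + e]invrK lef_pV2 ?posrE ?invr_gt0//; lra.
rewrite invey oppe0 adde0; congr (_%:E); apply/eqP; rewrite eq_le la/= leNgt.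
apply/negP => la'; have al : 0 < a - l by lra.
by have := mu_le al; rewrite muE.
Qed.

(** * Lengths under the two flows *)

Lemma ler1_normz (R : realType) (n : int) : n != 0 -> 1 <= `|n%:~R| :> R.
Proof. by move=> n0; rewrite -intr_norm ler1z -gtz0_ge1 normr_gt0. Qed.

(** If both coordinates are less than [c / 2 * T / |t|], where
    [T = |t| ^ kappa], then [|m|] is less than [T / 2 + T / 2], and the gap
    makes the second coordinate at least [c * T / |t|]. *)
Lemma no_short_horo (R : realType) (s kappa c t : R) :
  0 < c <= 1 -> 0 <= kappa <= 1 -> gap s kappa c -> 1 <= `|t| ->
  no_short 1 t 0 1 s (c / 2 * (`|t| `^ kappa / `|t|)).
Proof.
move=> /andP[c0 c1] /andP[k0 k1] sgap t1 m n mn.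
have t0 : 0 < `|t| by lra.
have T1 : 1 <= `|t| `^ kappa by rewrite -[leLHS](powRr0 `|t|) ler_powR.
have Tt : `|t| `^ kappa <= `|t| by rewrite -[leRHS]powRr1 ?ler_powR// ltW.
set T := `|t| `^ kappa in T1 Tt *; set u := T / `|t|.
have u0 : 0 < u by rewrite divr_gt0//; lra.
have u1 : u <= 1 by rewrite ler_pdivrMr// mul1r.
have ut : u * `|t| = T by rewrite divfK// gt_eqF.
set d := m%:~R * s + n%:~R; rewrite !mul1r mul0r add0r.
have cu : c / 2 * u <= u / 2 by nra.
have [m0|m0] := eqVneq m 0.
  right; rewrite /d m0 mul0r add0r; apply: (@le_trans _ _ 1); first by lra.
  by apply: ler1_normz; rewrite m0 in mn.
have [du|ud] := leP (c / 2 * u) `|d|; [by right|left].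
have td : `|t * d| <= T / 2.
  rewrite normrM; apply: (@le_trans _ _ (`|t| * (u / 2))).
    by rewrite ler_pM2l//; lra.
  by rewrite mulrA [`|t| * u]mulrC ut.
have mT : T <= `|m%:~R|.
  rewrite leNgt; apply/negP => /(sgap _ _ n t1 m0); rewrite -/T -/u -/d.
  by move: ud; nra.
have : `|m%:~R| <= `|m%:~R + t * d| + `|t * d|.
  by rewrite -{1}(addrK (t * d) m%:~R) ler_normB.
lra.
Qed.

(** The threshold [T = expR t ^ kappa] separates the [m] that are long after
    contraction by [expR (- t / 2)] from those whose second coordinate is long
    after expansion by [expR (t / 2)]. *)
Lemma no_short_geod (R : realType) (s kappa c t : R) :
  0 < c <= 1 -> 0 <= kappa <= 1 -> gap s kappa c -> 0 <= t ->
  no_short (expR (- t / 2)) 0 0 (expR (- - t / 2)) s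
    (c * (expR t `^ kappa / expR (t / 2))).
Proof.
move=> /andP[c0 c1] /andP[k0 k1] sgap t0 m n mn.
have e1 : 1 <= expR t by rewrite -expR0 ler_expR.
have T1 : 1 <= expR t `^ kappa by rewrite -[leLHS](powRr0 (expR t)) ler_powR.
have Tt : expR t `^ kappa <= expR t by rewrite -[leRHS]powRr1 ?ler_powR ?expR_ge0.
have sg := sgap _ _ n e1.
set T := expR t `^ kappa in T1 Tt sg *.
rewrite opprK mulNr expRN !mul0r addr0 add0r.
have eE : expR t = expR (t / 2) * expR (t / 2) by rewrite -expRD -splitr.
rewrite eE in Tt sg; have E0 : 0 < expR (t / 2) by exact: expR_gt0.
set E := expR (t / 2) in E0 Tt sg *; rewrite !normrM normfV (gtr0_norm E0).
set d := m%:~R * s + n%:~R.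
have cTT : c * (T / E) <= T / E by rewrite ler_piMl// divr_ge0 ?ltW//; lra.
have [m0|m0] := eqVneq m 0.
  right; rewrite /d m0 mul0r add0r; apply: (le_trans cTT).
  rewrite ler_pdivrMr//; apply: (le_trans Tt).
  rewrite mulrAC ler_peMr ?mulr_ge0 ?(ltW E0)//.
  by apply: ler1_normz; rewrite m0 in mn.
have [Tm|mT] := leP T `|m%:~R|.
  by left; apply: (le_trans cTT); rewrite mulrC ler_pM2l ?invr_gt0.
right; have := sg m m0 mT; rewrite -/d -(ler_pM2l E0); apply: le_trans.
by rewrite le_eqVlt; apply/orP; left; apply/eqP; field; rewrite gt_eqF.
Qed.

(** * The two upper limits *)

Lemma horo_limsup_le (R : realType) (s kappa c : R) :
  0 < c <= 1 -> 0 <= kappa <= 1 -> gap s kappa c ->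
  (limf_esup
    (fun t : R => (ln (alpha1 (act_set (horo t) (Lambda s))) / ln `|t|)%:E)
    (@abs_pinfty_nbhs R) <= (1 - kappa)%:E)%E.
Proof.
move=> c01 k01 sgap; apply: limf_esup_le => e e0.
have /andP[c0 c1] := c01.
exists (expR (Num.max 0 (- ln (c / 2) / e))) => t Mt.
have t1 : 1 < `|t| by apply: le_lt_trans Mt; rewrite -expR0 ler_expR le_max lexx.
have t0 : 0 < `|t| by lra.
have lt0 : 0 < ln `|t| by rewrite ln_gt0.
have large : - ln (c / 2) <= e * ln `|t|.
  rewrite [leRHS]mulrC -ler_pdivrMr//; apply/ltW; rewrite -ltr_expR lnK ?posrE//.
  by apply: le_lt_trans Mt; rewrite ler_expR le_max lexx orbT.
rewrite /= ler_pdivrMr//.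
have Tu0 : 0 < `|t| `^ kappa / `|t| by rewrite divr_gt0 ?powR_gt0.
have c20 : 0 < c / 2 by lra.
have := ln_alpha1_le (mulr_gt0 c20 Tu0) (no_short_horo c01 k01 sgap (ltW t1)).
rewrite lnM ?posrE// (@ln_div _ (`|t| `^ kappa)) ?posrE ?powR_gt0// ln_powR.
by move=> /le_trans; apply; lra.
Qed.

Lemma geod_limsup_le (R : realType) (s kappa c : R) :
  0 < c <= 1 -> 0 <= kappa <= 1 -> gap s kappa c ->
  (limf_esup
    (fun t : R => (ln (alpha1 (act_set (geod (- t)) (Lambda s))) / t)%:E)
    (pinfty_nbhs R) <= (2^-1 - kappa)%:E)%E.
Proof.
move=> c01 k01 sgap; apply: limf_esup_le => e e0.
have /andP[c0 c1] := c01.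
exists (Num.max 0 (- ln c / e)); split; first exact: num_real.
move=> t; rewrite gt_max => /andP[t0 large] /=.
rewrite ler_pdivrMr//.
move: large; rewrite ltr_pdivrMr// => large.
have Tu0 : 0 < expR t `^ kappa / expR (t / 2).
  by rewrite divr_gt0 ?powR_gt0 ?expR_gt0.
have := ln_alpha1_le (mulr_gt0 c0 Tu0) (no_short_geod c01 k01 sgap (ltW t0)).
rewrite lnM ?posrE// ln_div ?posrE ?powR_gt0 ?expR_gt0// ln_powR !expRK.
by move=> /le_trans; apply; lra.
Qed.

Lemma horo_limsup_ge (R : realType) (s nu : R) : irrational s -> 0 < nu ->
  infinite_set (approx_solutions s nu) ->
  ((1 - nu^-1)%:E <= limf_esup
    (fun t : R => (ln (alpha1 (act_set (horo t) (Lambda s))) / ln `|t|)%:E)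
    (@abs_pinfty_nbhs R))%E.
Proof.
move=> hs nu0 inf; apply: limf_esup_ge => e V e0 [M MV].
have [q [p [tau [tau1 Mtau q_le q0 dE]]]] := good_approximations M hs nu0 inf.
have tau0 : 0 < tau by lra.
have qR0 : 0 < q%:~R :> R by rewrite ltr0z.
set d := q%:~R * s + p%:~R in dE.
have d0 : d != 0 by rewrite -normr_eq0 dE gt_eqF// divr_gt0.
(* This [t] sends the vector [(q, d)] to [(0, d)]. *)
pose t := - (q%:~R / d).
have tE : `|t| = tau.
  by rewrite normrN normf_div dE gtr0_norm// invf_div mulrC divfK ?gt_eqF.
exists t; first by apply: MV; rewrite tE.
have t1 : 1 <= `|t| by rewrite tE ltW.
(* The trivial gap gives a crude lower bound on all lengths, enough for the
   supremum to be finite. *)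
have r0 : 0 < 1 / 2 * (`|t| `^ 0 / `|t|).
  by rewrite powRr0 mulr_gt0 ?divr_gt0// tE.
have c01 : 0 < (1 : R) <= 1 by rewrite ltr01 lexx.
have k01 : 0 <= (0 : R) <= 1 by rewrite ler01 lexx.
have qn0 : q != 0 by rewrite gt_eqF.
have short : `|1 * q%:~R + t * d| + `|0 * q%:~R + 1 * d| <=
    tau `^ nu^-1 / tau.
  rewrite !mul1r mul0r add0r /t mulNr divfK// subrr normr0 add0r dE.
  by rewrite ler_pM2r ?invr_gt0.
have ln_ge := ln_alpha1_ge r0 (no_short_horo c01 k01 (@gap0 R s) t1) qn0 short.
rewrite tE ler_pdivlMr ?ln_gt0//; apply: le_trans ln_ge.
rewrite ln_div ?posrE ?powR_gt0// ln_powR.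
by have := ln_gt0 tau1; nra.
Qed.

Lemma geod_limsup_ge (R : realType) (s nu : R) : irrational s -> 0 < nu ->
  infinite_set (approx_solutions s nu) ->
  ((2^-1 - nu^-1)%:E <= limf_esup
    (fun t : R => (ln (alpha1 (act_set (geod (- t)) (Lambda s))) / t)%:E)
    (pinfty_nbhs R))%E.
Proof.
move=> hs nu0 inf; apply: limf_esup_ge => e V e0 [M [_ MV]].
pose N := Num.max M (ln 2 / e).
have [q [p [tau [tau1 Ntau q_le q0 dE]]]] :=
  good_approximations (expR N) hs nu0 inf.
have tau0 : 0 < tau by lra.
have qR0 : 0 < q%:~R :> R by rewrite ltr0z.
set d := q%:~R * s + p%:~R in dE.
(* At this time both coordinates of the vector have size [q / sqrt tau]. *)
pose t := ln tau.
have tauE : tau = expR t by rewrite lnK.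
move: Ntau; rewrite tauE ltr_expR gt_max => /andP[Mt large].
exists t; first exact: MV.
have t0 : 0 < t by rewrite ln_gt0.
move: large; rewrite ltr_pdivrMr// => large.
(* The trivial gap gives a crude lower bound on all lengths, enough for the
   supremum to be finite. *)
have r0 : 0 < 1 * (expR t `^ 0 / expR (t / 2)).
  by rewrite powRr0 mul1r divr_gt0 ?expR_gt0.
have c01 : 0 < (1 : R) <= 1 by rewrite ltr01 lexx.
have k01 : 0 <= (0 : R) <= 1 by rewrite ler01 lexx.
have qn0 : q != 0 by rewrite gt_eqF.
have short : `|expR (- t / 2) * q%:~R + 0 * d| +
    `|0 * q%:~R + expR (- - t / 2) * d| <= 2 * (tau `^ nu^-1 / expR (t / 2)).
  rewrite !mul0r addr0 add0r opprK !normrM mulNr expRN normfV.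
  rewrite (gtr0_norm (expR_gt0 _)) (gtr0_norm qR0) dE.
  have -> : (expR (t / 2))^-1 * q%:~R + expR (t / 2) * (q%:~R / tau) =
      2 * (q%:~R / expR (t / 2)).
    by rewrite tauE {3}[t]splitr expRD; field; rewrite gt_eqF// expR_gt0.
  by rewrite ler_pM2l// ler_pM2r ?invr_gt0 ?expR_gt0.
have ln_ge := ln_alpha1_ge r0 (no_short_geod c01 k01 (@gap0 R s) (ltW t0))
  qn0 short.
rewrite ler_pdivlMr//; apply: le_trans ln_ge.
rewrite lnM ?posrE ?divr_gt0 ?powR_gt0 ?expR_gt0//.
rewrite ln_div ?posrE ?powR_gt0 ?expR_gt0// ln_powR expRK -/t; lra.
Qed.

Theorem proposition3p1 (R : realType) (s : R) (hs : irrational s) :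
  limf_esup
    (fun t : R => (ln (alpha1 (act_set (horo t) (Lambda s))) / ln `|t|)%:E)
    (@abs_pinfty_nbhs R) = (1 - (approx_exponent s)^-1)%E
  /\
  limf_esup
    (fun t : R => (ln (alpha1 (act_set (geod (- t)) (Lambda s))) / t)%:E)
    (pinfty_nbhs R) = ((2^-1)%:E - (approx_exponent s)^-1)%E.
Proof.
have c01 : 0 < (1 : R) <= 1 by rewrite ltr01 lexx.
have k01 : 0 <= (0 : R) <= 1 by rewrite ler01 lexx.
have nu01 (nu : R) : 1 <= nu -> 0 <= nu^-1 <= 1.
  by move=> nu1; rewrite invr_ge0 invf_le1; lra.
split; apply: esup_inv_eq.
- exact: approx_solutions1_infinite.
- by rewrite -[X in (_ <= X%:E)%E]subr0; exact: horo_limsup_le c01 k01 (@gap0 R s).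
- by move=> nu nu0; exact: horo_limsup_ge.
- move=> nu nu1 /contrapT fin; have [c c1 sgap] := gap_of_finite hs nu1 fin.
  exact: horo_limsup_le c1 (nu01 _ nu1) sgap.
- exact: approx_solutions1_infinite.
- by rewrite -[X in (_ <= X%:E)%E]subr0; exact: geod_limsup_le c01 k01 (@gap0 R s).
- by move=> nu nu0; exact: geod_limsup_ge.
- move=> nu nu1 /contrapT fin; have [c c1 sgap] := gap_of_finite hs nu1 fin.
  exact: geod_limsup_le c1 (nu01 _ nu1) sgap.
Qed.
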